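(* Regular finite decomposition complexity satisfies Fibering Permanence; that is, the collection $\mathfrak{R}$ of all metric families with regular finite decomposition complexity satisfies Fibering Permanence.
   Context: A metric family is a set of metric spaces. A map of metric families $F\colon\mathcal{X}\to\mathcal{Y}$ is a collection of functions $f\colon X\to Y$ with $X\in\mathcal{X}$, $Y\in\mathcal{Y}$, such that each element of $\mathcal{X}$ is the domain of at least one function in $F$. $F$ is coarse if there is a non-decreasing function $\rho\colon[0,\infty)\to[0,\infty)$ with $d_Y(f(x),f(y))\le\rho(d_X(x,y))$ for all $f\colon X\to Y$ in $F$ and $x,y\in X$. A subfamily of $\mathcal{Y}$ is a metric family each of whose members is a subspace of some $Y\in\mathcal{Y}$; the inverse image of a subfamily $\mathcal{B}$ is $F^{-1}(\mathcal{B})=\{f^{-1}(B)\mid B\in\mathcal{B},\ f\in F\}$ (where $B$ is a subspace of the codomain of $f$). $\mathcal{X}$ is bounded if $\sup_{X\in\mathcal{X}}\operatorname{diam}X<\infty$. $\operatorname{asdim}(\mathcal{X})\le n$ means: for every $r>0$, each $X\in\mathcal{X}$ has a decomposition $X=X_0\cup\dots\cup X_n$ where each $X_i$ is a union of subspaces $X_{ij}$, $j\in J_i$, with $d(x,y)>r$ whenever $x\in X_{ij}$, $y\in X_{ij'}$, $j\ne j'$, such that the family of all $X_{ij}$ (over all $X$, $i$, $j$) is bounded. $\mathcal{X}$ has finite asymptotic dimension if $\operatorname{asdim}(\mathcal{X})\le n$ for some $n$. Let $\mathfrak{R}_0$ be the collection of bounded metric families. For an ordinal $\alpha>0$, $\mathcal{X}\in\mathfrak{R}_\alpha$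 if there are a metric family $\mathcal{Y}$ with finite asymptotic dimension and a coarse map $F\colon\mathcal{X}\to\mathcal{Y}$ such that for every bounded subfamily $\mathcal{B}$ of $\mathcal{Y}$ there is an ordinal $\beta<\alpha$ with $F^{-1}(\mathcal{B})\in\mathfrak{R}_\beta$. A metric family has regular finite decomposition complexity (regular FDC), i.e. lies in $\mathfrak{R}$, if it lies in $\mathfrak{R}_\alpha$ for some countable ordinal $\alpha$. A collection $\mathfrak{C}$ of metric families satisfies Fibering Permanence if: whenever $F\colon\mathcal{X}\to\mathcal{Y}$ is a coarse map, $\mathcal{Y}\in\mathfrak{C}$, and $F^{-1}(\mathcal{Z})\in\mathfrak{C}$ for every bounded subfamily $\mathcal{Z}$ of $\mathcal{Y}$, then $\mathcal{X}\in\mathfrak{C}$. *)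

(* Defs.v *)
From Stdlib Require Export Reals FinFun.
From Stdlib Require Import ProofIrrelevance.
From Stdlib Require Fin.

Set Implicit Arguments.

Local Open Scope R_scope.

Definition subset (T : Type) : Type := T -> Prop.

Lemma subspace_dist_refl (M : Metric_Space) (A : subset (Base M))
    (x y : {x : Base M | A x}) :
  dist M (proj1_sig x) (proj1_sig y) = 0 <-> x = y.
Proof.
rewrite (dist_refl M); split.
- destruct x as [x hx], y as [y hy]; simpl; intro e; subst y.
  now rewrite (proof_irrelevance _ hx hy).
- now intros ->.
Qed.

Definition subspace (M : Metric_Space) (A : subset (Base M)) : Metric_Space :=
  Build_Metric_Space {x : Base M | A x}
    (fun x y => dist M (proj1_sig x) (proj1_sig y))
    (fun x y => dist_pos M (proj1_sig x) (proj1_sig y))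
    (fun x y => dist_sym M (proj1_sig x) (proj1_sig y))
    (subspace_dist_refl M A)
    (fun x y z => dist_tri M (proj1_sig x) (proj1_sig y) (proj1_sig z)).

(** A set of metric spaces is presented as a family indexed by a type.
    Repetitions are allowed; none of the notions below depends on them. *)
Record metric_family : Type := MetricFamily {
  index : Type;
  member :> index -> Metric_Space
}.

Definition bounded (X : metric_family) : Prop :=
  exists D : R, forall (i : index X) (x y : Base (X i)), dist (X i) x y <= D.

(** A collection of functions between members, given by its membership
    predicate. *)
Record family_map (X Y : metric_family) : Type := FamilyMap {
  contains : forall (i : index X) (j : index Y),
    (Base (X i) -> Base (Y j)) -> Prop;
  contains_total : forall i : index X, exists j f, contains i j f
}.

Definition coarse (X Y : metric_family) (F : family_map X Y) : Prop :=
  exists rho : R -> R,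
    (forall t, 0 <= t -> 0 <= rho t) /\
    (forall s t, 0 <= s -> s <= t -> rho s <= rho t) /\
    (forall i j f, contains F i j f -> forall x y : Base (X i),
      dist (Y j) (f x) (f y) <= rho (dist (X i) x y)).

(** A set of subspaces of members of [Y].  Each subspace is recorded together
    with the member it sits in, so that [S j B] says that the subspace [B] of
    [Y j] belongs to the subfamily. *)
Definition subfamily (Y : metric_family) : Type :=
  forall j : index Y, subset (Base (Y j)) -> Prop.

Definition family_of_subfamily (Y : metric_family) (S : subfamily Y) :
    metric_family :=
  MetricFamily (index := {j : index Y & {B : subset (Base (Y j)) | S j B}})
    (fun p => subspace (Y (projT1 p)) (proj1_sig (projT2 p))).

Coercion family_of_subfamily : subfamily >-> metric_family.

Definition inverse_image (X Y : metric_family) (F : family_map X Y)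
    (S : subfamily Y) : subfamily X :=
  fun i A => exists (j : index Y) (f : Base (X i) -> Base (Y j))
    (B : subset (Base (Y j))),
    contains F i j f /\ S j B /\ A = (fun x => B (f x)).

(** [M = X_0 u ... u X_n], where each [X_k] is the union of the pieces
    [X_kj], [j : J_k], any two of which are at distance greater than [r] in
    the pointwise sense. *)
Record decomposition (r : R) (n : nat) (M : Metric_Space) : Type :=
  Decomposition {
    layer : Fin.t (S n) -> subset (Base M);
    piece_index : Fin.t (S n) -> Type;
    piece : forall k, piece_index k -> subset (Base M);
    layers_cover : forall x, exists k, layer k x;
    layer_union : forall k x, layer k x <-> exists j : piece_index k, piece j x;
    pieces_separated : forall k (j j' : piece_index k) x y,
      j <> j' -> piece j x -> piece j' y -> dist M x y > r
  }.

Arguments piece {r n M} d {k} j _.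

Definition family_of_pieces (X : metric_family) (r : R) (n : nat)
    (D : forall i : index X, decomposition r n (X i)) : metric_family :=
  MetricFamily
    (index := {i : index X & {k : Fin.t (S n) & piece_index (D i) k}})
    (fun p => subspace (X (projT1 p))
      (piece (D (projT1 p)) (projT2 (projT2 p)))).

Arguments family_of_pieces {X r n} D.

Definition asdim_le (X : metric_family) (n : nat) : Prop :=
  forall r : R, 0 < r ->
    exists D : forall i : index X, decomposition r n (X i),
      bounded (family_of_pieces D).

Definition finite_asdim (X : metric_family) : Prop :=
  exists n : nat, asdim_le X n.

(** An ordinal is presented by a well-ordered type of that order type. *)
Record ordinal : Type := Ordinal {
  carrier :> Type;
  lt_in : carrier -> carrier -> Prop;
  lt_in_wf : well_founded lt_in;
  lt_in_trans : forall x y z, lt_in x y -> lt_in y z -> lt_in x z;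
  lt_in_total : forall x y, lt_in x y \/ x = y \/ lt_in y x
}.

(** [b < a] when [b] is order-isomorphic to a proper initial segment of [a]. *)
Definition ord_lt (b a : ordinal) : Prop :=
  exists (s : a) (f : b -> a),
    (forall x y, lt_in b x y <-> lt_in a (f x) (f y)) /\
    (forall z, lt_in a z s <-> exists x, f x = z).

Definition countable_ordinal (a : ordinal) : Prop :=
  exists f : a -> nat, Injective f.

(** The hierarchy [R_a].  Since [ord_lt] is well-founded, this inductive
    predicate is the one given by transfinite recursion on [a].  The ordinal
    [0] is presented by exactly the empty well-orders. *)
Inductive regular_FDC_at : ordinal -> metric_family -> Prop :=
| regular_FDC_zero (a : ordinal) (X : metric_family) :
    ~ inhabited a -> bounded X -> regular_FDC_at a X
| regular_FDC_pos (a : ordinal) (X Y : metric_family) (F : family_map X Y) :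
    inhabited a -> finite_asdim Y -> coarse F ->
    (forall S : subfamily Y, bounded S ->
      exists b : ordinal, ord_lt b a /\ regular_FDC_at b (inverse_image F S)) ->
    regular_FDC_at a X.

Definition regular_FDC (X : metric_family) : Prop :=
  exists a : ordinal, countable_ordinal a /\ regular_FDC_at a X.

Definition fibering_permanence (C : metric_family -> Prop) : Prop :=
  forall (X Y : metric_family) (F : family_map X Y),
    coarse F -> C Y ->
    (forall Z : subfamily Y, bounded Z -> C (inverse_image F Z)) ->
    C X.

(* Main.v *)
Require Import Defs.
From Stdlib Require Import Classical ClassicalEpsilon ProofIrrelevance Lra.
From Stdlib Require Import Eqdep_dec Arith Cantor Relation_Operators Wellfounded.

(** Write the fibration as [F : X -> Y], with [Y] in [R_a].  The natural proof
    is an induction on [a].  If [a = 0] then [Y] is itself a bounded subfamily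
    of [Y], so [X] embeds isometrically in a fibre of [F].  If [a > 0], take a
    coarse map [G : Y -> W] to a family of finite asymptotic dimension whose
    fibres [G^-1(S)] lie in lower stages.  Then [F] restricts to a coarse map
    from [(G o F)^-1(S)] to [G^-1(S)] whose fibres embed isometrically in
    fibres of [F] ([restriction_fibre_embeds]), so each [(G o F)^-1(S)] is
    regular by induction, and it remains to conclude that [X] is.

    That last step, [regular_FDC_of_fibres], is where countability enters: the
    ordinal attached to [(G o F)^-1(S)] depends on [S], and there may be
    uncountably many [S].  However, every bounded [S] is contained in one of
    the countably many families [diam_le n] of all subspaces of diameter at
    most [n], so countably many countable ordinals have to be dominated by one
    countable ordinal.  Their sum along the natural numbers, followed by a top
    element, does this.

    All comparisons rest on the monotonicity lemma [regular_FDC_at_mono]: the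
    hierarchy passes to isometrically embedded families and along strictly
    increasing maps of ordinals.  Strictly increasing maps are used rather than
    isomorphisms onto initial segments because the summands of a sum are not
    initial segments; the comparison theorem for well-orders is thereby
    avoided. *)

Set Implicit Arguments.

Local Open Scope R_scope.

(** * Isometric embeddings and bounded families *)

(** This relation stands in for inclusion of one set of metric spaces in
    another: it identifies a subspace of a subspace with a subspace, and a
    space with its full subspace. *)
Definition family_embeds (X' X : metric_family) : Prop :=
  forall i' : index X', exists (i : index X) (e : Base (X' i') -> Base (X i)),
    forall x y, dist (X i) (e x) (e y) = dist (X' i') x y.

Lemma bounded_embeds (X' X : metric_family) :
  family_embeds X' X -> bounded X -> bounded X'.
Proof.
intros E [D HD]; exists D; intros i' x y.
destruct (E i') as (i & e & He).
rewrite <- He; apply HD.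
Qed.

Lemma subfamily_embeds (X : metric_family) (S : subfamily X) :
  family_embeds S X.
Proof.
intros [i [A HA]]; exists i, (@proj1_sig _ _); reflexivity.
Qed.

Definition whole_decomposition (r : R) (M : Metric_Space) :
  decomposition r 0 M.
Proof.
refine (@Decomposition r 0 M (fun _ _ => True) (fun _ => unit)
          (fun _ _ _ => True) _ _ _).
- intros x; exists Fin.F1; exact I.
- intros k x; split; [intros _; exists tt; exact I | trivial].
- intros k [] [] x y H; contradiction H; reflexivity.
Defined.

Lemma bounded_finite_asdim (X : metric_family) : bounded X -> finite_asdim X.
Proof.
intros [D HD]; exists 0%nat; intros r _.
exists (fun i => whole_decomposition r (X i)).
exists D; intros [i [k p]] [x hx] [y hy]; apply HD.
Qed.

(** The subspaces of diameter at most [D]: the largest subfamily with the bound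
    [D]. *)
Definition diam_le (Y : metric_family) (D : R) : subfamily Y :=
  fun j B => forall x y, B x -> B y -> dist (Y j) x y <= D.

Lemma bounded_diam_le (Y : metric_family) (D : R) : bounded (diam_le Y D).
Proof.
exists D; intros [j [B HB]] [x hx] [y hy]; now apply HB.
Qed.

Lemma bounded_sub_diam_le (Y : metric_family) (S : subfamily Y) :
  bounded S -> exists n : nat, forall j B, S j B -> diam_le Y (INR n) j B.
Proof.
intros [D HD].
destruct (INR_unbounded D) as [n Hn].
exists n; intros j B HB x y hx hy.
generalize (HD (existT _ j (exist _ B HB)) (exist _ x hx) (exist _ y hy)).
simpl; lra.
Qed.

(** * Family maps and their fibres *)

(** All isometric embeddings between members are included, so that no equality
    of indices is needed to single out the identity functions. *)
Definition id_map (X : metric_family) : family_map X X.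
Proof.
refine (@FamilyMap X X (fun i j f =>
  forall x y, dist (X j) (f x) (f y) = dist (X i) x y) _).
intro i; exists i, (fun x => x); reflexivity.
Defined.

Lemma coarse_id_map (X : metric_family) : coarse (id_map X).
Proof.
exists (fun t => t); repeat split; auto.
intros i j f Hf x y; rewrite Hf; apply Rle_refl.
Qed.

Definition comp_map (X Y W : metric_family)
  (G : family_map Y W) (F : family_map X Y) : family_map X W.
Proof.
refine (@FamilyMap X W (fun i k h => exists j f g,
  contains F i j f /\ contains G j k g /\ h = (fun x => g (f x))) _).
intro i.
destruct (contains_total F i) as (j & f & Hf).
destruct (contains_total G j) as (k & g & Hg).
exists k, (fun x => g (f x)), j, f, g; auto.
Defined.

Lemma coarse_comp_map (X Y W : metric_family)
  (G : family_map Y W) (F : family_map X Y) :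
  coarse G -> coarse F -> coarse (comp_map G F).
Proof.
intros (s & s0 & smono & Hs) (r & r0 & rmono & Hr).
exists (fun t => s (r t)); repeat split; auto.
intros i k h (j & f & g & Hf & Hg & ->) x y.
eapply Rle_trans; [now apply (Hs _ _ _ Hg)|].
apply smono; [apply Rge_le, dist_pos | now apply Hr].
Qed.

Definition precomp_embedding (X' X Y : metric_family)
  (E : family_embeds X' X) (F : family_map X Y) : family_map X' Y.
Proof.
refine (@FamilyMap X' Y (fun i' j h => exists i e f,
  (forall x y, dist (X i) (e x) (e y) = dist (X' i') x y) /\
  contains F i j f /\ h = (fun x => f (e x))) _).
intro i'.
destruct (E i') as (i & e & He).
destruct (contains_total F i) as (j & f & Hf).
exists j, (fun x => f (e x)), i, e, f; auto.
Defined.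

Lemma coarse_precomp_embedding (X' X Y : metric_family)
  (E : family_embeds X' X) (F : family_map X Y) :
  coarse F -> coarse (precomp_embedding E F).
Proof.
intros (r & r0 & rmono & Hr); exists r; repeat split; auto.
intros i' j h (i & e & f & He & Hf & ->) x y.
rewrite <- He; now apply Hr.
Qed.

Lemma inverse_image_precomp_embeds (X' X Y : metric_family)
  (E : family_embeds X' X) (F : family_map X Y) (S : subfamily Y) :
  family_embeds (inverse_image (precomp_embedding E F) S) (inverse_image F S).
Proof.
intros [i' [A' (j & h & B & (i & e & f & He & Hf & ->) & HB & ->)]].
assert (HA : inverse_image F S i (fun x => B (f x))) by (exists j, f, B; auto).
exists (existT _ i (exist _ _ HA)).
exists (fun x => exist (fun x => B (f x)) (e (proj1_sig x)) (proj2_sig x)).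
intros x y; apply He.
Qed.

Lemma inverse_image_mono (X Y : metric_family) (F : family_map X Y)
  (S S' : subfamily Y) :
  (forall j B, S j B -> S' j B) ->
  family_embeds (inverse_image F S) (inverse_image F S').
Proof.
intros H [i [A HA]].
assert (HA' : inverse_image F S' i A).
{ destruct HA as (j & f & B & Hf & HB & ->); exists j, f, B; auto. }
exists (existT _ i (exist _ A HA')), (fun x => x); reflexivity.
Qed.

(** When the base is bounded, its members are themselves an admissible choice
    of bounded subspaces, and their inverse images are everything. *)
Lemma embeds_total_fibre (X Y : metric_family) (F : family_map X Y) (D : R) :
  (forall j (x y : Base (Y j)), dist (Y j) x y <= D) ->
  family_embeds X (inverse_image F (diam_le Y D)).
Proof.
intros HD i.
destruct (contains_total F i) as (j & f & Hf).
assert (HA : inverse_image F (diam_le Y D) i (fun _ => True)).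
{ exists j, f, (fun _ => True); repeat split; auto.
  intros x y _ _; apply HD. }
exists (existT _ i (exist _ _ HA)), (fun x => exist (fun _ => True) x I).
reflexivity.
Qed.

(** [F] restricted to the members of [(G o F)^-1(S)].  Its functions are the
    corestrictions of functions of [F]: this is all that coarseness and the
    comparison of fibres require, and the member of [G^-1(S)] in which they
    land is left free. *)
Definition restriction (X Y W : metric_family) (G : family_map Y W)
  (F : family_map X Y) (S : subfamily W) :
  family_map (inverse_image (comp_map G F) S) (inverse_image G S).
Proof.
refine (@FamilyMap (inverse_image (comp_map G F) S) (inverse_image G S)
  (fun p q u => exists f, contains F (projT1 p) (projT1 q) f /\
     forall x, proj1_sig (u x) = f (proj1_sig x)) _).
intros [i [A (k & h & C & (j & f & g & Hf & Hg & ->) & HC & ->)]].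
assert (HB : inverse_image G S j (fun y => C (g y))) by (exists k, g, C; auto).
exists (existT _ j (exist _ _ HB)).
exists (fun x => exist (fun y => C (g y)) (f (proj1_sig x)) (proj2_sig x)).
exists f; auto.
Defined.

Lemma coarse_restriction (X Y W : metric_family) (G : family_map Y W)
  (F : family_map X Y) (S : subfamily W) :
  coarse F -> coarse (restriction G F S).
Proof.
intros (r & r0 & rmono & Hr); exists r; repeat split; auto.
intros p q u (f & Hf & Hu) x y; simpl.
rewrite !Hu; now apply Hr.
Qed.

(** A bounded subspace [T] of a subspace of [Y j] is a bounded subspace of
    [Y j], so the inverse image of [T] under the restriction lies in the
    inverse image of [T] under [F]. *)
Lemma restriction_fibre_embeds (X Y W : metric_family) (G : family_map Y W)
  (F : family_map X Y) (S : subfamily W) (Z : subfamily (inverse_image G S))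
  (D : R) :
  (forall q T, Z q T -> diam_le (inverse_image G S) D q T) ->
  family_embeds (inverse_image (restriction G F S) Z)
                (inverse_image F (diam_le Y D)).
Proof.
intros HZ [p [A (q & u & T & (f & Hf & Hu) & HT & ->)]].
set (T' := fun y => exists h, T (exist _ y h)).
assert (HA : inverse_image F (diam_le Y D) (projT1 p) (fun x => T' (f x))).
{ exists (projT1 q), f, T'; repeat split; auto.
  intros y y' [h Hy] [h' Hy'].
  exact (HZ _ _ HT _ _ Hy Hy'). }
assert (H : forall x, T (u x) -> T' (f (proj1_sig x))).
{ intros x Hx; rewrite <- Hu; destruct (u x) as [y h]; now exists h. }
exists (existT _ (projT1 p) (exist _ _ HA)).
exists (fun x => exist (fun x => T' (f x)) (proj1_sig (proj1_sig x))
                   (H _ (proj2_sig x))).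
reflexivity.
Qed.

(** * Ordinals *)

Definition ord_embeds (a b : ordinal) : Prop :=
  exists e : a -> b, forall x y, lt_in a x y -> lt_in b (e x) (e y).

(** The segments of [b] present all the ordinals smaller than [b]. *)
Definition segment (b : ordinal) (s : b) : ordinal.
Proof.
refine (@Ordinal {x : b | lt_in b x s}
  (fun x y => lt_in b (proj1_sig x) (proj1_sig y)) _ _ _).
- apply wf_inverse_image, lt_in_wf.
- intros x y z; apply lt_in_trans.
- intros [x hx] [y hy]; simpl.
  destruct (lt_in_total b x y) as [|[<-|]]; auto.
  right; left; now rewrite (proof_irrelevance _ hx hy).
Defined.

Lemma segment_lt (b : ordinal) (s : b) : ord_lt (segment b s) b.
Proof.
exists s, (@proj1_sig _ _); split; [reflexivity|].
intro z; split.
- intro h; now exists (exist _ z h).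
- intros [[x h] <-]; exact h.
Qed.

Lemma exists_empty_segment (b : ordinal) :
  inhabited b -> exists s : b, ~ inhabited (segment b s).
Proof.
intros [t]; apply NNPP; intro H.
(* Without a least element, no element at all can exist. *)
induction t as [t IH] using (well_founded_ind (lt_in_wf b)).
apply H; exists t; intros [[x hx]]; exact (IH x hx).
Qed.

Definition succ_lt (a : ordinal) (p q : option a) : Prop :=
  match p, q with
  | Some x, Some y => lt_in a x y
  | Some _, None => True
  | None, _ => False
  end.

Definition succ_ord (a : ordinal) : ordinal.
Proof.
refine (@Ordinal (option a) (succ_lt a) _ _ _).
- (* Below [Some x] lie only old elements, so these are accessible before the
     top element is considered. *)
  assert (H : forall x : a, Acc (succ_lt a) (Some x)).
  { intro x; induction x as [x IH] using (well_founded_ind (lt_in_wf a)).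
    constructor; intros [y|] hy; [now apply IH | destruct hy]. }
  intros [x|]; [apply H|].
  constructor; intros [y|] hy; [apply H | destruct hy].
- intros [x|] [y|] [z|]; simpl; try tauto; apply lt_in_trans.
- intros [x|] [y|]; simpl; auto.
  destruct (lt_in_total a x y) as [|[<-|]]; auto.
Defined.

Definition omega_sum (a : nat -> ordinal) : ordinal.
Proof.
refine (@Ordinal {n : nat & a n}
  (lexprod nat (fun n => a n) lt (fun n => lt_in (a n))) _ _ _).
- apply wf_lexprod; [exact lt_wf | intro n; apply lt_in_wf].
- intros [m x] [n y] [p z] H1 H2.
  inversion H1 as [m1 n1 x1 y1 L1|m1 x1 y1 L1]; subst;
  inversion H2 as [m2 n2 x2 y2 L2|m2 x2 y2 L2]; subst.
  + left; now apply Nat.lt_trans with n.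
  + now left.
  + now left.
  + repeat match goal with
    | E : existT _ _ _ = existT _ _ _ |- _ =>
        apply (inj_pair2_eq_dec _ Nat.eq_dec) in E; subst
    end.
    right; now apply lt_in_trans with y.
- intros [m x] [n y].
  destruct (Nat.lt_total m n) as [h|[<-|h]].
  + left; now left.
  + destruct (lt_in_total (a m) x y) as [h|[<-|h]]; auto.
    * left; now right.
    * right; right; now right.
  + right; right; now left.
Defined.

Lemma countable_succ_ord (a : ordinal) :
  countable_ordinal a -> countable_ordinal (succ_ord a).
Proof.
intros [f Hf].
exists (fun p => match p with Some x => S (f x) | None => 0%nat end).
intros [x|] [y|] E; try discriminate; auto.
injection E as E; now rewrite (Hf _ _ E).
Qed.

Lemma countable_omega_sum (a : nat -> ordinal) :
  (forall n, countable_ordinal (a n)) -> countable_ordinal (omega_sum a).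
Proof.
intro H.
set (f := fun n => constructive_indefinite_description _ (H n)).
exists (fun p : omega_sum a =>
  to_nat (projT1 p, proj1_sig (f (projT1 p)) (projT2 p))).
intros [m x] [n y] E.
apply to_nat_inj in E; injection E as E0 E; simpl in E0, E; subst m.
now rewrite (proj2_sig (f n) _ _ E).
Qed.

(** Each summand embeds in the segment below the top element. *)
Lemma summand_embeds_below_top (a : nat -> ordinal) (n : nat) :
  ord_embeds (a n) (segment (succ_ord (omega_sum a)) None).
Proof.
exists (fun x => exist (fun p => succ_lt (omega_sum a) p None)
                   (Some (existT _ n x)) I).
intros x y h; simpl; now right.
Qed.

(** * Regular families *)

(** The recursive occurrence in [regular_FDC_pos] is nested below [exists] and
    [/\], so this induction principle has to be spelled out. *)
Lemma regular_FDC_at_nested_ind (P : ordinal -> metric_family -> Prop) :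
  (forall (a : ordinal) X, ~ inhabited a -> bounded X -> P a X) ->
  (forall (a : ordinal) X Y (F : family_map X Y),
    inhabited a -> finite_asdim Y -> coarse F ->
    (forall S : subfamily Y, bounded S ->
      exists b, ord_lt b a /\ regular_FDC_at b (inverse_image F S) /\
                P b (inverse_image F S)) ->
    P a X) ->
  forall a X, regular_FDC_at a X -> P a X.
Proof.
intros H0 H1.
fix IH 3.
intros a X [a' X' ha hX | a' X' Y F ha hY hF HS].
- now apply H0.
- apply (H1 _ _ _ F ha hY hF).
  intros S hS; destruct (HS S hS) as (b & hb & R).
  exists b; repeat split; auto.
Qed.

(** The identity map of a bounded family shows that it lies in every positive
    stage: the family has asymptotic dimension 0, its subfamilies are bounded,
    and the segment below the least element of [b] presents the ordinal 0. *)
Lemma regular_FDC_at_bounded (b : ordinal) (X : metric_family) :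
  bounded X -> regular_FDC_at b X.
Proof.
intro hX.
destruct (classic (inhabited b)) as [hb|hb].
- destruct (exists_empty_segment b hb) as [s hs].
  apply (regular_FDC_pos hb (bounded_finite_asdim hX)
           (coarse_id_map X)).
  intros S _; exists (segment b s); split; [apply segment_lt|].
  apply regular_FDC_zero; auto.
  eapply bounded_embeds; [apply subfamily_embeds | exact hX].
- now apply regular_FDC_zero.
Qed.

(** If [c < a] is the segment below [s] and [e : a -> b] is strictly
    increasing, then [e] maps [c] into the segment of [b] below [e s]; so the
    stage of each fibre can again be compared by a strictly increasing map. *)
Lemma regular_FDC_at_mono (a b : ordinal) (X X' : metric_family) :
  regular_FDC_at a X -> ord_embeds a b -> family_embeds X' X ->
  regular_FDC_at b X'.
Proof.
intro H; revert b X'.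
induction H as [a X ha hX | a X Y F ha hY hF IH]
  using regular_FDC_at_nested_ind; intros b X' [e He] E.
- apply regular_FDC_at_bounded; exact (bounded_embeds E hX).
- apply (@regular_FDC_pos b X' Y (precomp_embedding E F)).
  + destruct ha as [s]; exact (inhabits (e s)).
  + exact hY.
  + now apply coarse_precomp_embedding.
  + intros S hS.
    destruct (IH S hS) as (c & (s & f & Hf & Hs) & _ & IHc).
    exists (segment b (e s)); split; [apply segment_lt|].
    apply IHc; [|apply inverse_image_precomp_embeds].
    assert (below : forall x, lt_in b (e (f x)) (e s)).
    { intro x; apply He, Hs; now exists x. }
    exists (fun x => exist (fun z => lt_in b z (e s)) (e (f x)) (below x)).
    intros x y h; apply He, Hf, h.
Qed.

Lemma regular_FDC_embeds (X' X : metric_family) :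
  family_embeds X' X -> regular_FDC X -> regular_FDC X'.
Proof.
intros E (a & ca & Ha); exists a; split; auto.
apply (regular_FDC_at_mono Ha); auto.
exists (fun x => x); auto.
Qed.

(** The case of fibering permanence over a base of finite asymptotic
    dimension.  It suffices to exceed the ordinals of the fibres over the
    families [diam_le n], because every bounded subfamily lies in one of
    them. *)
Lemma regular_FDC_of_fibres (X W : metric_family) (F : family_map X W) :
  finite_asdim W -> coarse F ->
  (forall S : subfamily W, bounded S -> regular_FDC (inverse_image F S)) ->
  regular_FDC X.
Proof.
intros hW hF H.
set (w := fun n => constructive_indefinite_description _
                     (H _ (bounded_diam_le W (INR n)))).
set (a := fun n => proj1_sig (w n)).
exists (succ_ord (omega_sum a)); split.
- apply countable_succ_ord, countable_omega_sum.
  intro n; exact (proj1 (proj2_sig (w n))).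
- apply (@regular_FDC_pos (succ_ord (omega_sum a)) X W F); auto.
  + exact (inhabits None).
  + intros S hS; destruct (bounded_sub_diam_le hS) as [n Hn].
    exists (segment (succ_ord (omega_sum a)) None); split; [apply segment_lt|].
    apply (regular_FDC_at_mono (proj2 (proj2_sig (w n)))).
    * exact (summand_embeds_below_top a n).
    * now apply inverse_image_mono.
Qed.

Theorem theorem5p2 : fibering_permanence regular_FDC.
Proof.
intros X Y F hF (a & _ & HY); revert X F hF.
induction HY as [a Y ha [D HD] | a Y W G ha hW hG IH]
  using regular_FDC_at_nested_ind; intros X F hF HF.
- apply (regular_FDC_embeds (embeds_total_fibre F HD)).
  apply HF, bounded_diam_le.
- apply (regular_FDC_of_fibres (F := comp_map G F) hW).
  { now apply coarse_comp_map. }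
  intros S hS; destruct (IH S hS) as (b & _ & _ & IHb).
  apply (IHb _ (restriction G F S)); [now apply coarse_restriction|].
  intros Z hZ; destruct (bounded_sub_diam_le hZ) as [n Hn].
  apply (regular_FDC_embeds (restriction_fibre_embeds (F := F) Hn)).
  apply HF, bounded_diam_le.
Qed.
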